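(* Let $n,t,s$ be integers with $n/2-t$ a nonnegative integer, and let $m$ be an integer with $n\ge m>4(s+t)^2$ such that a Hadamard matrix of size $m$ exists. Then \[ \chi_F\left[K\left(n,\tfrac n2-t,s\right)\right]\le 2m. \]
   Context: $K(n,k,s)$ is the graph on $\binom{[n]}{k}$ in which two $k$-subsets of $[n]=\{1,\dots,n\}$ are adjacent iff they share fewer than $s$ elements. For $A\subseteq[n]$, the Frankl set is $I_A=\{v\in\binom{[n]}{k}: |v\cap A|\ge (|A|+s)/2\}$. The F-chromatic number $\chi_F[K(n,k,s)]$ is the minimum number of colors in a proper coloring in which every color class is contained in some Frankl set. A Hadamard matrix of size $m$ is an $m\times m$ matrix with entries $\pm1$ whose rows are mutually orthogonal. *)

(* Defs.v *)
From HB Require Import structures.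
From mathcomp Require Import all_boot all_order all_algebra.
Set Implicit Arguments.
Unset Strict Implicit.
Unset Printing Implicit Defensive.
Import Order.TTheory GRing.Theory Num.Theory.
Local Open Scope ring_scope.

(* The ground set {1, ..., n} is modelled by 'I_n. *)
Definition ksubset (n k : nat) : finType := {v : {set 'I_n} | #|v| == k}.

(* The graph K(n,k,s).  Distinctness is required explicitly: when k < s a
   vertex shares fewer than s elements with itself. *)
Definition K_adj (n k : nat) (s : int) : rel (ksubset n k) :=
  fun u v => (u != v) && (#|val u :&: val v|%:Z < s).

Definition frankl_set (n k : nat) (s : int) (A : {set 'I_n}) :
    {set ksubset n k} :=
  [set v : ksubset n k | (#|A|%:R + s%:~R) / 2 <= #|val v :&: A|%:R :> rat].

Definition proper_coloring (V : finType) (e : rel V) (q : nat)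
    (c : V -> 'I_q) : Prop :=
  forall u v, e u v -> c u != c v.

Definition F_coloring (n k : nat) (s : int) (q : nat)
    (c : ksubset n k -> 'I_q) : Prop :=
  proper_coloring (K_adj s) c /\
  forall i : 'I_q, exists A : {set 'I_n},
    [set v | c v == i] \subset frankl_set k s A.

(* chi_F[K(n,k,s)] = q.  This is a relation rather than a function because
   F-colorings need not exist: if s > k all Frankl sets are empty. *)
Definition is_F_chromatic_number (n k : nat) (s : int) (q : nat) : Prop :=
  (exists c : ksubset n k -> 'I_q, F_coloring s c) /\
  forall r : nat,
    (exists c : ksubset n k -> 'I_r, F_coloring s c) -> (q <= r)%N.

Definition hadamard (m : nat) (H : 'M[int]_m) : Prop :=
  (forall i j, H i j = 1 \/ H i j = -1) /\
  forall i j, i != j -> row i H *m (row j H)^T = 0.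

(* Main.v *)
(** Encode a k-subset v as a sign vector x on [n], so that v lies in the Frankl
    set of A iff x(A) >= s, while x([n]) = -2t.  Partition [n] into m blocks of
    odd size and give every element of the c-th block the c-th column of H; the
    block sums z_c of x are odd, so |z|^2 >= m, and |Hz|^2 = m |z|^2 yields a row
    i with (Hz)_i^2 >= m > 4(s+t)^2.  This row splits [n] into A and its
    complement with |x(A) - x(~A)| >= 2|s+t| and x(A) + x(~A) = -2t, hence one of
    the two has x-sum at least s.  The m rows thus give 2m Frankl sets covering
    all vertices.  Odd blocks exist because n and m are both even, except
    possibly when s + t = 0, where one of A, ~A works for any A. *)
Require Import Defs.
From HB Require Import structures.
From mathcomp Require Import all_boot all_order all_algebra.
From mathcomp Require Import zify lra.
From Stdlib Require Import Classical.
Set Implicit Arguments.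
Unset Strict Implicit.
Unset Printing Implicit Defensive.
Import Order.TTheory GRing.Theory Num.Theory.
Local Open Scope ring_scope.

(** Turns one F-coloring into an exact F-chromatic number bounded by its number of colors. The
    excluded middle replaces a decision procedure for [P]. *)
Lemma exists_least (P : nat -> Prop) (q : nat) :
  P q -> exists p, (P p /\ forall r, P r -> (p <= r)%N) /\ (p <= q)%N.
Proof.
elim/ltn_ind: q => q IH Pq.
case: (classic (exists2 r, P r & (r < q)%N)) => [[r Pr ltrq]|no_less].
  have [p [least_p le_pr]] := IH r ltrq Pr.
  by exists p; split=> //; apply: leq_trans le_pr (ltnW ltrq).
exists q; split=> //; split=> // r Pr; rewrite leqNgt.
by apply/negP => ltrq; apply: no_less; exists r.
Qed.

Definition sign_sum (n : nat) (v A : {set 'I_n}) : int :=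
  \sum_(j in A) (if j \in v then 1 else -1).

Lemma sign_sumE (n : nat) (v A : {set 'I_n}) :
  sign_sum v A = 2 * #|v :&: A|%:Z - #|A|%:Z.
Proof.
have -> : #|A| = (#|v :&: A| + #|A :\: v|)%N by rewrite setIC cardsID.
rewrite /sign_sum (big_setID v) /= setIC.
rewrite (eq_bigr (fun=> 1)) => [|j /setIP[-> //]].
rewrite [X in _ + X](eq_bigr (fun=> -1)) => [|j /setDP[_ /negbTE-> //]].
rewrite !sumr_const mulNrn !natz.
have E (a b : nat) : a%:Z - b%:Z = 2 * a%:Z - (a + b)%N%:Z by lia.
exact: E.
Qed.

Lemma sign_sumC (n : nat) (v A : {set 'I_n}) :
  sign_sum v A + sign_sum v (~: A) = 2 * #|v|%:Z - n%:Z.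
Proof.
rewrite !sign_sumE; have := cardsC A; have := cardsID A v.
rewrite card_ord setDE; lia.
Qed.

Lemma in_frankl_set (n k : nat) (s : int) (A : {set 'I_n}) (v : ksubset n k) :
  (v \in frankl_set k s A) = (s <= sign_sum (val v) A).
Proof.
rewrite inE ler_pdivrMr // sign_sumE lerBrDl -(ler_int rat) rmorphD rmorphM.
by rewrite /= mulrC -!pmulrn.
Qed.

(** If u and v lie in the Frankl set of B, then |u :&: B| + |v :&: B| >= |B| + s, while the union of
    these two sets has at most |B| elements. So u and v share at least s elements and are not
    adjacent: coloring each vertex by a chosen covering index is proper. *)
Lemma F_coloring_of_cover (n k : nat) (s : int) (I : finType)
    (A : I -> {set 'I_n}) :
  (forall v : ksubset n k, exists i, v \in frankl_set k s (A i)) ->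
  exists c : ksubset n k -> 'I_#|I|, F_coloring s c.
Proof.
move=> cover; pose g v := xchoose (cover v).
have gP v : v \in frankl_set k s (A (g v)) by apply: (xchooseP (cover v)).
exists (fun v => enum_rank (g v)); split=> [u v /andP[_ lt_s]|i].
  apply/negP => /eqP/enum_rank_inj guv.
  have := gP u; have := gP v; rewrite -guv !in_frankl_set !sign_sumE.
  set B := A _ => vB uB.
  have := cardsUI (val u :&: B) (val v :&: B).
  have : (#|(val u :&: B) :|: (val v :&: B)| <= #|B|)%N.
    by apply: subset_leq_card; rewrite subUset !subsetIr.
  have : (#|(val u :&: B) :&: (val v :&: B)| <= #|val u :&: val v|)%N.
    by apply: subset_leq_card; rewrite setISS ?subsetIl.
  lia.
by exists (A (enum_val i)); apply/subsetP => v; rewrite inE => /eqP <-;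
  rewrite enum_rankK.
Qed.

(* [inord] sends every j >= m to 0, so the 0th block has size n - m + 1 and the
   others are singletons. *)
Lemma odd_partition (n m : nat) :
  (0 < m <= n)%N -> odd m = odd n ->
  exists f : 'I_n -> 'I_m, forall c, odd #|[set j | f j == c]|.
Proof.
case: m => // m lemn parity; exists (fun j => inord j).
pose B (c : 'I_m.+1) : {set 'I_n} := [set j : 'I_n | inord j == c].
have B1 (c : 'I_m.+1) : c != ord0 -> #|B c| = 1%N.
  move=> c0; rewrite -(cards1 (widen_ord lemn c)); apply: eq_card => j.
  rewrite !inE -!val_eqE /=; case: (ltnP j m.+1) => [/inordK-> //|lemj].
  have ltjm : (j < m.+1)%N = false by lia.
  rewrite /inord /insubd insubF //=.
  rewrite eq_sym -[0%N]/(val (ord0 : 'I_m.+1)) val_eqE (negbTE c0).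
  by apply/esym/negbTE; have := ltn_ord c; lia.
have sumB : (\sum_c #|B c| = n)%N.
  rewrite -[RHS]card_ord -sum1_card.
  rewrite (partition_big (fun j : 'I_n => inord j : 'I_m.+1) predT) //=.
  by apply: eq_bigr => d _; rewrite -sum1_card; apply: eq_bigl => i;
    rewrite inE.
move=> c; rewrite -/(B c); have [->|/B1-> //] := eqVneq c ord0.
(* The [m] blocks other than the 0th are singletons, so n = |B 0| + m; as n has the parity of
   [m.+1], |B 0| is odd. *)
move: sumB; rewrite (bigD1 ord0) //= (eq_bigr (fun=> 1%N)) // sum1_card.
rewrite cardC1 card_ord /= => /(congr1 odd).
by rewrite -parity oddD /=; case: (odd m); case: (odd _).
Qed.

(** Two orthogonal sign rows agree in exactly half of the columns; for m > 1 the first and last rows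
    are distinct. *)
Lemma hadamard_even (m : nat) (H : 'M[int]_m) :
  hadamard H -> (1 < m)%N -> ~~ odd m.
Proof.
case: m H => [|[|m]] // H [H1 Ho] _.
have /matrixP/(_ 0 0) := Ho ord0 ord_max isT.
rewrite !mxE => E.
pose p j := (H ord0 j * H ord_max j == 1).
have : \sum_j (2 * (p j : nat)%:Z - 1) = 0.
  rewrite -[RHS]E; apply: eq_bigr => j _; rewrite !mxE /p.
  by case: (H1 ord0 j) => ->; case: (H1 ord_max j) => ->.
rewrite sumrB -mulr_sumr sumr_const card_ord.
rewrite natz; move: (\sum_j _) => a; lia.
Qed.

Lemma hadamard_norm (m : nat) (H : 'M[int]_m) (z : 'I_m -> int) :
  hadamard H ->
  \sum_i (\sum_j H i j * z j) ^+ 2 = m%:Z * \sum_j z j ^+ 2.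
Proof.
case: m H z => [|m] H z [H1 Ho]; first by rewrite !big_ord0.
have HHT : H *m H^T = m.+1%:Z%:M.
  apply/matrixP => i j; rewrite !mxE; have [<-|ij] := eqVneq i j.
    rewrite mulr1n (eq_bigr (fun=> 1)) ?sumr_const ?card_ord ?natz // => l _.
    by rewrite mxE; case: (H1 i l) => ->.
  have /matrixP/(_ 0 0) := Ho i j ij; rewrite !mxE mulr0n => E.
  by rewrite -[RHS]E; apply: eq_bigr => l _; rewrite !mxE.
(* The hypothesis is about rows, but |Hz|^2 involves the columns, through [H^T *m H]. Over the
   rationals [H] can be inverted, and its right inverse is also a left inverse. *)
pose Q : 'M[rat]_m.+1 := map_mx intr H.
have QTQ : Q^T *m Q = m.+1%:R%:M.
  have m0 : m.+1%:R != 0 :> rat by rewrite pnatr_eq0.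
  have : Q *m (m.+1%:R^-1 *: Q^T) = 1%:M.
    rewrite -scalemxAr /Q map_trmx -map_mxM HHT map_scalar_mx /=.
    by rewrite scale_scalar_mx -pmulrn mulVf.
  move/mulmx1C; rewrite -scalemxAl => /(congr1 (fun M => m.+1%:R *: M)).
  by rewrite scalerA divff // scale1r scale_scalar_mx mulr1.
pose zc : 'cV[rat]_m.+1 := \col_j (z j)%:~R.
have : (Q *m zc)^T *m (Q *m zc) = m.+1%:R *: (zc^T *m zc).
  by rewrite trmx_mul -mulmxA (mulmxA Q^T) QTQ mul_scalar_mx -scalemxAr.
move=> /matrixP/(_ 0 0); rewrite !mxE => E.
apply: (@intr_inj rat); rewrite rmorphM !rmorph_sum /=.
transitivity (\sum_j (Q *m zc)^T 0 j * (Q *m zc) j 0).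
  apply: eq_bigr => i _; rewrite !mxE rmorphXn rmorph_sum /= expr2.
  by congr (_ * _); apply: eq_bigr => j _; rewrite !mxE rmorphM.
rewrite E -pmulrn; congr (_ * _).
by apply: eq_bigr => j _; rewrite !mxE rmorphXn /= expr2.
Qed.

Lemma hadamard_large_row (n m : nat) (H : 'M[int]_m) (v : {set 'I_n})
    (f : 'I_n -> 'I_m) :
  hadamard H -> (0 < m)%N -> (forall c, odd #|[set j | f j == c]|) ->
  exists i, let A := [set j | H i (f j) == 1] in
    m%:Z <= (sign_sum v A - sign_sum v (~: A)) ^+ 2.
Proof.
move=> hadH m0 fodd.
pose z c := sign_sum v [set j | f j == c].
have z1 c : 1 <= z c ^+ 2.
  have : z c != 0.
    move: (fodd c); rewrite /z sign_sumE.
    by move: #|_ :&: _| #|_| => a b; lia.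
  by move: (z c) => a; nia.
have yE i : let A := [set j | H i (f j) == 1] in
    sign_sum v A - sign_sum v (~: A) = \sum_c H i c * z c.
  move=> A; rewrite /z /sign_sum.
  under [RHS]eq_bigr do rewrite mulr_sumr.
  under [RHS]eq_bigr => c _ do under eq_bigl do rewrite inE.
  rewrite -sumrN /=.
  transitivity (\sum_j H i (f j) * (if j \in v then 1 else -1)); last first.
    rewrite (partition_big f predT) //=; apply: eq_bigr => c _.
    by apply: eq_bigr => j /eqP->.
  rewrite [RHS](bigID (mem A)) /=; congr (_ + _).
    by apply: eq_bigr => j; rewrite inE => /eqP->; rewrite mul1r.
  apply: eq_big => j; rewrite !inE // => Hj.
  by case: (hadH.1 i (f j)) Hj => ->; rewrite ?eqxx ?mulN1r.
(* If every row had square at most m - 1, the total would be at most m(m - 1), but it is m |z|^2 >=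
   m^2. *)
have [[i le_i]|none] := classic (exists i, m%:Z <= (\sum_c H i c * z c) ^+ 2).
  by exists i; rewrite /= yE.
have : m%:Z * m%:Z <= \sum_i (\sum_j H i j * z j) ^+ 2.
  rewrite hadamard_norm // ler_wpM2l //.
  rewrite -[leLHS]natz -[X in X%:R]card_ord -sumr_const.
  by apply: ler_sum => c _; apply: z1.
have : \sum_i (\sum_j H i j * z j) ^+ 2 <= \sum_(i < m) (m%:Z - 1).
  apply: ler_sum => i _; rewrite leNgt; apply/negP => lt_i.
  by apply: none; exists i; move: lt_i; lia.
rewrite sumr_const card_ord -mulr_natl natz; nia.
Qed.

Theorem theorem6 (n : nat) (t s : int) (k : nat)
    (hk : n%:R / 2 - t%:~R = k%:R :> rat)
    (m : nat) (hmn : (m <= n)%N) (hm : 4 * (s + t) ^+ 2 < m%:Z)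
    (hH : exists H : 'M[int]_m, hadamard H) :
  exists chi : nat, is_F_chromatic_number n k s chi /\ (chi <= 2 * m)%N.
Proof.
have nE : n%:Z = 2 * k%:Z + 2 * t.
  apply: (@intr_inj rat); rewrite rmorphD !rmorphM /= -!pmulrn.
  by move: hk; lra.
case: hH => H hadH; apply: exists_least.
have m0 : (0 < m)%N by nia.
have [f fP] : exists f : 'I_n -> 'I_m, forall v : {set 'I_n}, exists i,
    let A := [set j | H i (f j) == 1] in
    4 * (s + t) ^+ 2 <= (sign_sum v A - sign_sum v (~: A)) ^+ 2.
  (* When s + t = 0 the required gap is 0, so any map and row will do. Otherwise m > 4, so m is
     even, and n is even by [nE]. *)
  have [st0|st0] := eqVneq (s + t) 0.
    exists (fun=> Ordinal m0) => v; exists (Ordinal m0) => A.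
    by rewrite st0 expr0n mulr0 sqr_ge0.
  have even_m : ~~ odd m by apply: (hadamard_even hadH); nia.
  have parity : odd m = odd n by lia.
  have m_range : (0 < m <= n)%N by rewrite m0.
  have [f fodd] := odd_partition m_range parity.
  exists f => v; have [i le_m] := hadamard_large_row v hadH m0 fodd.
  by exists i; apply: le_trans (ltW hm) le_m.
pose A (p : 'I_m * bool) :=
  let B := [set j | H p.1 (f j) == 1] in if p.2 then B else ~: B.
have -> : (2 * m)%N = #|{: 'I_m * bool}|.
  by rewrite card_prod card_ord card_bool mulnC.
apply: (@F_coloring_of_cover _ _ _ _ A) => v.
have [i /=] := fP (val v); set B := [set j | _] => gap.
have sumB := sign_sumC (val v) B; rewrite (eqP (valP v)) in sumB.
(* Twice the larger sum is the total -2t plus the absolute gap, hence at least -2t + 2|s + t| >=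
   2s. *)
have large : s <= sign_sum (val v) B \/ s <= sign_sum (val v) (~: B).
  move: gap sumB; move: (sign_sum _ _) (sign_sum _ _) => a b; nia.
by case: large => large; [exists (i, true)|exists (i, false)];
  rewrite in_frankl_set.
Qed.
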